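(* Let $G$ be a finite group. Then $G$ is a minimal non-Iwasawa group if and only if one of the following holds: (i) $G$ is a minimal non-modular $p$-group for some prime $p$ (that is, $G$ is a $p$-group which is not modular, but all of whose proper subgroups are modular); or (ii) $G$ is a Schmidt group $G=PQ$, where $P$ is its normal Sylow $p$-subgroup and $Q$ is a cyclic Sylow $q$-subgroup ($p\neq q$ primes), and $P$ is a modular group.
   Context: All groups are finite. $L(G)$ denotes the lattice of all subgroups of a group $G$. A subgroup $H$ of $G$ is permutable if $HK=KH$ for all $K\in L(G)$. $G$ is an Iwasawa group if all its subgroups are permutable. $G$ is a modular group if the lattice $L(G)$ is modular (equivalently, every subgroup of $G$ is a modular element of $L(G)$). For a class of groups $\mathcal{X}$, a group $G$ is a minimal non-$\mathcal{X}$ group if $G\notin\mathcal{X}$ but all proper subgroups of $G$ belong to $\mathcal{X}$. A Schmidt group is a minimal non-nilpotent group, i.e. a finite non-nilpotent group all of whose proper subgroups are nilpotent. By a classical theorem of Schmidt, such a group has order $p^mq^n$ for distinct primes $p,q$ (with $m,n\geq 1$), has a unique (hence normal) Sylow $p$-subgroup $P$ and a cyclic (non-normal) Sylow $q$-subgroup $Q$, so that $G=PQ$ is a semidirect product of $P$ by $Q$; the notation $G=PQ$ for a Schmidt group always refers to this decomposition. *)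

(* Defs.v *)
From HB Require Import structures.
From mathcomp Require Import all_boot all_fingroup all_solvable.

Set Implicit Arguments.
Unset Strict Implicit.
Unset Printing Implicit Defensive.

Local Open Scope group_scope.

Section Defs.

Variable gT : finGroupType.
Implicit Types G H K P Q X Y Z : {group gT}.

(* The products H * K and K * H are products of subsets. *)
Definition permutable G H : Prop :=
  H \subset G /\ forall K, K \subset G -> H * K = K * H.

Definition Iwasawa G : Prop := forall H, H \subset G -> permutable G H.

(* The modular law of L(G), whose meet is :&: and whose join is <*>;
   this is unrelated to the modular p-groups 'Mod_(p ^ n) of extremal.v. *)
Definition modular_group G : Prop :=
  forall X Y Z, X \subset G -> Y \subset G -> Z \subset G ->
  X \subset Z -> (X <*> Y) :&: Z = X <*> (Y :&: Z).

Definition minimal_non (C : {group gT} -> Prop) G : Prop :=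
  ~ C G /\ forall H, H \proper G -> C H.

Definition Schmidt_group G : Prop :=
  minimal_non (fun H => nilpotent H) G.

(* The decomposition G = PQ of a Schmidt group: by Schmidt's theorem it exists
   for every such G, p and q are determined by G, and so is P. *)
Definition Schmidt_decomposition G (p q : nat) P Q : Prop :=
  [/\ [/\ prime p, prime q & p != q],
      p.-Sylow(G) P /\ P <| G,
      [/\ q.-Sylow(G) Q, cyclic Q & ~~ (Q <| G)]
    & P ><| Q = G].

End Defs.

(* Main.v *)
(* A finite group is Iwasawa if and only if it is nilpotent and modular: a
   permutable maximal subgroup is normal, products of permuting subgroups satisfy
   Dedekind's law, and conversely HK = KH follows by climbing a maximal chain from
   H :&: K to H, along which modularity makes each join with K maximal, hence
   normal, in the next one.  A nilpotent minimal non-Iwasawa group must be a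
   p-group, since the Iwasawa property passes to products of coprime factors; a
   non-nilpotent one is a Schmidt group, and its structure is Schmidt's theorem.
   The crux of the latter is that a simple group with all proper subgroups
   nilpotent is solvable: otherwise its maximal subgroups meet trivially, and the
   conjugates of two non-conjugate ones contain too many elements. *)

Require Import Defs.
From mathcomp Require Import all_boot all_fingroup all_solvable.

Set Implicit Arguments.
Unset Strict Implicit.
Unset Printing Implicit Defensive.

Local Open Scope group_scope.

(** * Iwasawa groups as nilpotent modular groups *)

Section Iwasawa.

Variable gT : finGroupType.
Implicit Types G H K M N P Q : {group gT}.

(** Normal Sylow subgroups, being nilpotent, lie in the Fitting subgroup, and together they generate
    [G]. *)
Lemma Sylow_normal_nilpotent G :
  (forall P, Sylow G P -> P <| G) -> nilpotent G.
Proof.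
move=> nsSyl; have sGF: G \subset 'F(G).
  rewrite -{1}(Sylow_gen G) gen_subG; apply/bigcupsP=> P sylP.
  have [p _ /pHall_pgroup/pgroup_nil nilP] := SylowP _ _ sylP.
  exact: Fitting_max (nsSyl P sylP) nilP.
exact: nilpotentS sGF (Fitting_nil G).
Qed.

(** If [M :^ g] differs from [M], the product of the two is a subgroup, equal to [G] by maximality.
    Writing [g] itself as an element of this product and solving for [g] puts it in [M]. *)
Lemma permutable_maximal_normal G M : maximal M G -> permutable G M -> M <| G.
Proof.
move=> maxM [sMG permM]; rewrite /normal sMG; apply/subsetP=> g Gg.
have sMgG: M :^ g \subset G by rewrite conj_subG.
have [eqMg | neqMg] := eqVneq (M :^ g) M; first by rewrite inE eqMg.
have cMMg: commute M (M :^ g) by exact: (permM (M :^ g)%G).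
have /maximal_eqP[_ maxM'] : maximal_eq M G by rewrite /maximal_eq maxM orbT.
have joinG : M <*> M :^ g = G.
  case: (maxM' (M <*> M :^ g)%G) => //; first exact: joing_subl.
    by rewrite join_subG sMG.
  move=> /= joinM; case/negP: neqMg; rewrite eqEcard cardJg leqnn andbT.
  by rewrite -{2}joinM joing_subr.
suff Mg: g \in M by rewrite inE conjGid.
have : g \in M * M :^ g by rewrite -(comm_joingE cMMg) joinG.
case/mulsgP=> a _ Ma /imsetP[b Mb ->] def_g.
have e : a * (g^-1 * b) = 1.
  by apply: (mulIg g); rewrite mul1g -!mulgA -conjgE -def_g.
have {}e : b^-1 * g = a.
  by apply: invg_inj; rewrite invMg invgK -(mulKg a (g^-1 * b)) e mulg1.
by rewrite -(groupMl g (groupVr Mb)) e.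
Qed.

Lemma Iwasawa_nilpotent G : Iwasawa G -> nilpotent G.
Proof.
move=> iwG; apply: Sylow_normal_nilpotent => P /SylowP[p _ sylP].
have [sPG _ _] := and3P sylP.
(* A maximal [M] above a proper normalizer ['N_G(P)] would be normal, and the Frattini argument
   would give [G = M * 'N_G(P) = M]. *)
have [NG | [M maxM sNM]] := maximal_exists (subsetIl G 'N(P)).
  by rewrite /normal sPG -NG subsetIr.
have [sMG _] := andP (maxgroupp maxM).
have nsMG := permutable_maximal_normal maxM (iwG M sMG).
have sPM : P \subset M.
  by apply: subset_trans sNM; rewrite subsetI sPG normG.
have defG := Frattini_arg nsMG (pHall_subl sPM sMG sylP).
have:= maxgroupp maxM; rewrite properE => /andP[_ /negP[]].
by rewrite -{1}defG mulG_subG subxx.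
Qed.

Lemma Iwasawa_modular G : Iwasawa G -> modular_group G.
Proof.
move=> iwG X Y Z sXG sYG sZG sXZ.
have [_ permX] := iwG X sXG.
rewrite (comm_joingE (permX Y sYG)) comm_joingE; last first.
  by apply: (permX (Y :&: Z)%G); rewrite subIset ?sYG.
by rewrite group_modl.
Qed.

Lemma modular_groupS G H : H \subset G -> modular_group G -> modular_group H.
Proof.
move=> sHG modG X Y Z sX sY sZ; apply: modG; exact: subset_trans sHG.
Qed.

Lemma nilpotent_maximal_normal G M : nilpotent G -> maximal M G -> M <| G.
Proof.
move=> nilG /maxgroupP[ltMG maxM]; have sMG := proper_sub ltMG.
rewrite /normal sMG; have:= nilpotent_proper_norm nilG ltMG => ltMN.
have := subsetIl G 'N(M); rewrite subEproper => /predU1P[<- | ltNG].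
  exact: subsetIr.
have /= eNM := maxM ('N_G(M))%G ltNG (proper_sub ltMN).
by move: ltMN; rewrite eNM properxx.
Qed.

Lemma nilpotent_modular_Iwasawa G :
  nilpotent G -> modular_group G -> Iwasawa G.
Proof.
move=> nilG modG H sHG; split=> // K sKG.
(* This inclusion makes [H * K] a group, which is equivalent to [H] and [K] permuting. *)
suff: H <*> K \subset H * K.
  move=> sJ; have: group_set (H * K).
    have -> : H * K = H <*> K.
      by apply/eqP; rewrite eqEsubset mulG_subG joing_subl joing_subr.
    exact: groupP.
  by move/comm_group_setP.
have [n] := ubnP #|H|; elim: n H sHG => // n IHn H sHG; rewrite ltnS => leHn.
have [sHK | [M maxM sIM]] := maximal_exists (subsetIl H K).
  rewrite joingC (joing_idPl _) ?mulG_subr //.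
  by rewrite -sHK subsetIr.
have ltMH := maxgroupp maxM; have sMH := proper_sub ltMH.
have sMG := subset_trans sMH sHG.
have sMK : M <*> K \subset M * K.
  by apply: IHn => //; apply: leq_trans leHn; apply: proper_card.
have sMK_HK : M <*> K \subset H <*> K by rewrite genS ?setSU.
have sJG : H <*> K \subset G by rewrite join_subG sHG.
have [eqJ | [L maxL sL]] := maximal_exists sMK_HK.
  by rewrite -eqJ (subset_trans sMK) ?mulSg.
have [/andP[sLJ _] _] := maxgroupP maxL.
have sKL : K \subset L by apply: subset_trans sL; apply: joing_subr.
have sML : M \subset L by apply: subset_trans sL; apply: joing_subl.
(* Modularity gives [L = K <*> (H :&: L)], where [H :&: L] is [M] or [H] by maximality of [M]. It is
   not [H], since [L] is proper in the join. *)
have defL : L :=: M <*> K.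
  have := modG K H L sKG sHG (subset_trans sLJ sJG) sKL.
  rewrite (joingC K H) (setIidPr sLJ) => eL.
  have /maximal_eqP[_ maxM'] : maximal_eq M H by rewrite /maximal_eq maxM orbT.
  have sMI : M \subset H :&: L by rewrite subsetI sMH.
  have [/= eM | /= eH] := maxM' (H :&: L)%G sMI (subsetIl _ _).
    by rewrite joingC eL -eM.
  have:= maxgroupp maxL; rewrite properE => /andP[_ /negP[]].
  by rewrite join_subG sKL andbT -eH subsetIr.
have nLJ := normal_norm (nilpotent_maximal_normal (nilpotentS sJG nilG) maxL).
have nLH := subset_trans (joing_subl H K) nLJ.
(* As [H] normalizes [L], the join is [H * L], contained in [H * (M * K) = H * K]. *)
have -> : H <*> K = H <*> L.
  apply/eqP; rewrite eqEsubset !join_subG !joing_subl sLJ /= andbT.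
  exact: subset_trans sKL (joing_subr _ _).
rewrite norm_joinEl // defL (subset_trans (mulgS _ sMK)) // mulgA.
by rewrite mulSg // mulGSid.
Qed.

Lemma IwasawaP G : Iwasawa G <-> nilpotent G /\ modular_group G.
Proof.
split=> [iwG | [nilG modG]]; last exact: nilpotent_modular_Iwasawa.
by split; [apply: Iwasawa_nilpotent | apply: Iwasawa_modular].
Qed.

Lemma abelian_Iwasawa G : abelian G -> Iwasawa G.
Proof.
move=> cGG H sHG; split=> // K sKG; apply/normC/cents_norm.
exact: subset_trans sHG (subset_trans cGG (centS sKG)).
Qed.

(** Each subgroup is the product of its [pi]-core and its [pi^']-core, which lie in those of [G].
    These centralize each other, so permutability can be checked on each core separately. *)
Lemma pcore_Iwasawa_nilpotent (pi : nat_pred) G :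
  nilpotent G -> Iwasawa 'O_pi(G)%G -> Iwasawa 'O_pi^'(G)%G -> Iwasawa G.
Proof.
move=> nilG iwA iwB H sHG; split=> // K sKG.
have [_ _ cAB _] := dprodP (nilpotent_pcoreC pi nilG).
have sub rho (L : {group gT}) : L \subset G -> 'O_rho(L) \subset 'O_rho(G).
  move=> sLG; rewrite (sub_normal_Hall (nilpotent_pcore_Hall rho nilG)) ?pcore_normal //.
    exact: pcore_pgroup.
  exact: subset_trans (pcore_sub _ _) sLG.
have [_ defH _ _] := dprodP (nilpotent_pcoreC pi (nilpotentS sHG nilG)).
have [_ defK _ _] := dprodP (nilpotent_pcoreC pi (nilpotentS sKG nilG)).
have comm (L1 L2 : {group gT}) : L1 \subset G -> L2 \subset G ->
  'O_pi^'(L1) * 'O_pi(L2) = 'O_pi(L2) * 'O_pi^'(L1).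
  move=> s1 s2; apply/normC/cents_norm.
  exact: subset_trans (sub _ _ s1) (subset_trans cAB (centS (sub _ _ s2))).
have /= cA := (iwA 'O_pi(H)%G (sub _ _ sHG)).2 'O_pi(K)%G (sub _ _ sKG).
have /= cB := (iwB 'O_pi^'(H)%G (sub _ _ sHG)).2 'O_pi^'(K)%G (sub _ _ sKG).
have shuffle (L1 L2 : {group gT}) : L1 \subset G -> L2 \subset G ->
  'O_pi(L1) * 'O_pi^'(L1) * ('O_pi(L2) * 'O_pi^'(L2)) =
  'O_pi(L1) * 'O_pi(L2) * ('O_pi^'(L1) * 'O_pi^'(L2)).
  by move=> s1 s2; rewrite -mulgA (mulgA 'O_pi^'(L1)) comm // !mulgA.
by rewrite -defH -defK !shuffle // cA cB.
Qed.

End Iwasawa.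

(** * Simple groups with nilpotent proper subgroups *)

Lemma simple_maximal_TI (gT : finGroupType) (G M N : {group gT}) :
    simple G -> (forall H : {group gT}, H \proper G -> nilpotent H) ->
  maximal M G -> maximal N G -> M :!=: N -> M :&: N = 1.
Proof.
(* For a counterexample with #|M :&: N| maximal, normalizers grow in the nilpotent
   groups M and N, so a maximal L containing 'N_G(M :&: N) equals both. *)
move=> simG nilG; have [n] := ubnP (#|G| - #|M :&: N|).
elim: n M N => // n IHn M N; rewrite ltnS => leDn maxM maxN neqMN.
apply/eqP/idPn => ntD.
have ltMG := maxgroupp maxM; have ltNG := maxgroupp maxN.
have ltDG : M :&: N \proper G by rewrite (sub_proper_trans (subsetIl M N)).
have nN : ~~ (G \subset 'N(M :&: N)).
  apply/negP=> nDG; have [_ /(_ (M :&: N)%G)] := simpleP _ simG.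
  rewrite /normal (proper_sub ltDG) nDG => /(_ isT)[/eqP | /=eD].
    exact/negP.
  by rewrite eD properxx in ltDG.
have [eNG | [L maxL sNL]] := maximal_exists (subsetIl G 'N(M :&: N)).
  by case/negP: nN; rewrite -{1}eNG subsetIr.
have key (K : {group gT}) : maximal K G -> M :&: N \proper K -> K :=: L.
  move=> maxK ltDK; have ltKG := maxgroupp maxK; apply/eqP/idPn=> neqKL.
  have ltDKL : M :&: N \proper K :&: L.
    apply: proper_sub_trans (nilpotent_proper_norm (nilG K ltKG) ltDK) _.
    by rewrite subsetI subsetIl (subset_trans _ sNL) ?setSI ?proper_sub.
  have KL1 : K :&: L = 1.
    apply: IHn => //; apply: leq_trans leDn.
    apply: ltn_sub2l (proper_card ltDKL).
    exact: proper_card.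
  by move: ltDKL; rewrite KL1 => /proper_sub; rewrite subG1 (negPf ntD).
have notsub (K1 K2 : {group gT}) :
    maximal K1 G -> maximal K2 G -> K1 :!=: K2 -> ~~ (K1 \subset K2).
  move=> /maxgroupP[_ maxK1] /maxgroupp ltK2 neqK.
  by apply: contraNN neqK => sK12; rewrite (maxK1 K2).
have eML : M :=: L.
  by apply: key => //; rewrite properE subsetIl subsetI subxx notsub.
have eNL : N :=: L.
  by apply: key => //; rewrite properE subsetIr subsetI subxx andbT notsub // eq_sym.
by case/eqP: neqMN; rewrite eML eNL.
Qed.

(** Distinct conjugates of [M] are maximal and so meet trivially, while simplicity forces [M] to be
    its own normalizer. This gives the size of the class support of [M^#]. *)
Lemma simple_maximal_normedTI (gT : finGroupType) (G M : {group gT}) :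
    simple G -> (forall H : {group gT}, H \proper G -> nilpotent H) ->
  maximal M G -> M :!=: 1 -> normedTI M^# G M.
Proof.
move=> simG nilG maxM ntM; have ltMG := maxgroupp maxM.
apply/normedTI_P; split=> [||g Gg].
- by rewrite setD_eq0 subG1.
- by rewrite subsetI proper_sub // normD1 normG.
rewrite -setI_eq0 => /set0Pn[z /setIP[/setD1P[ntz Mz]]].
rewrite conjD1g => /setD1P[_ Mgz].
have nMg : M :^ g = M.
  apply/eqP/idPn => neq.
  have maxMg : maximal (M :^ g)%G G by rewrite -(conjGid Gg) maximalJ.
  have := @simple_maximal_TI _ G (M :^ g)%G M simG nilG maxMg maxM neq.
  move/setP/(_ z); rewrite !inE Mgz Mz => /esym e1.
  by rewrite e1 in ntz.
have [_ /(_ ('N_G(M))%G)] := maxgroupP maxM.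
have := subsetIl G 'N(M); rewrite subEproper => /predU1P[eN | ltN].
  have [_ /(_ M)] := simpleP _ simG.
  rewrite /normal (proper_sub ltMG) -{1}eN subsetIr => /(_ isT)[/eqP | /= eM].
    by rewrite (negPf ntM).
  by rewrite eM properxx in ltMG.
move=> /(_ ltN)/=; rewrite subsetI proper_sub // normG => /(_ isT) <-.
by rewrite !inE Gg nMg subxx.
Qed.

Lemma simple_nilpotent_proper_sol (gT : finGroupType) (G : {group gT}) :
    simple G -> (forall H : {group gT}, H \proper G -> nilpotent H) ->
  solvable G.
Proof.
move=> simG nilG; apply/idPn => nsolG.
have maxE x : x \in G -> {M : {group gT} | maximal M G & x \in M}.
  move=> Gx; apply: sig2W; have sxG : <[x]> \subset G by rewrite cycle_subG.
  have [eG | [M maxM]] := maximal_exists sxG.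
    by case/negP: nsolG; rewrite -eG abelian_sol ?cycle_abelian.
  by rewrite cycle_subG; exists M.
(* The class support has [(#|M| - 1) * #|G : M|] elements, at least half of [#|G|] because
   [#|M| >= 2]. *)
have cardE (M : {group gT}) : maximal M G -> M :!=: 1 ->
    (#|class_support M^# G| + #|G : M| = #|G|)%N /\ (#|G| >= 2 * #|G : M|)%N.
  move=> maxM ntM; have sMG := proper_sub (maxgroupp maxM).
  rewrite (card_support_normedTI (simple_maximal_normedTI simG nilG maxM ntM)).
  rewrite -(Lagrange sMG) (cardsD1 1 M) group1 mulnDl mul1n addnC; split=> //.
  rewrite -mulSn leq_mul2r ltnS.
  by rewrite card_gt0 setD_eq0 subG1 ntM orbT.
have subE (M : {group gT}) : maximal M G -> class_support M^# G \subset G^#.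
  move=> maxM; have sMG := proper_sub (maxgroupp maxM).
  rewrite class_supportEr; apply/bigcupsP=> g Gg.
  by rewrite conjD1g setSD // conj_subG.
have [ntG _] := simpleP _ simG; have [x Gx ntx] := trivgPn _ ntG.
have [M maxM Mx] := maxE x Gx.
have ntM : M :!=: 1 by apply/trivgPn; exists x.
have [cM leM] := cardE M maxM ntM.
have sMG := proper_sub (maxgroupp maxM).
have gt1 : 1 < #|G : M| by rewrite indexg_gt1; case/andP: (maxgroupp maxM).
have cG : #|G| = #|G^#|.+1 by rewrite (cardsD1 1 G) group1.
(* The support of [M^#] misses at least one nontrivial [y]; a maximal [N] containing [y] is then not
   conjugate to [M]. *)
have : ~~ (G^# \subset class_support M^# G).
  apply/negP=> /subset_leq_card; rewrite -ltnS -cG -cM -[X in _ <= X]addn1.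
  by rewrite leq_add2l leqNgt gt1.
case/subsetPn=> y /setD1P[nty Gy] notMy.
have [N maxN Ny] := maxE y Gy.
have ntN : N :!=: 1 by apply/trivgPn; exists y.
have [cN leN] := cardE N maxN ntN.
have dis : class_support M^# G :&: class_support N^# G = set0.
  apply/setP=> z; rewrite in_set0; apply/negP=> /setIP[].
  rewrite !class_supportEr => /bigcupP[g Gg]; rewrite conjD1g => /setD1P[ntz Mgz].
  case/bigcupP=> h Gh; rewrite conjD1g => /setD1P[_ Nhz].
  have maxJ (K : {group gT}) k : maximal K G -> k \in G -> maximal (K :^ k)%G G.
    by move=> maxK Gk; rewrite -(conjGid Gk) maximalJ.
  have eqc : M :^ g = N :^ h.
    apply/eqP/idPn=> neq.
    have := @simple_maximal_TI _ G (M :^ g)%G (N :^ h)%G simG nilG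
      (maxJ M g maxM Gg) (maxJ N h maxN Gh) neq.
    by move/setP/(_ z); rewrite !inE Mgz Nhz (negPf ntz).
  case/negP: notMy; rewrite class_supportEr; apply/bigcupP.
  exists (g * h^-1); first by rewrite groupM ?groupV.
  by rewrite conjD1g !inE nty conjsgM eqc -conjsgM mulgV conjsg1.
have : class_support M^# G :|: class_support N^# G \subset G^#.
  by rewrite subUset !subE.
(* Two disjoint supports, each of size at least [#|G| / 2], do not fit into the [#|G| - 1] elements
   of [G^#]. *)
move/subset_leq_card; rewrite cardsU dis cards0 subn0 -ltnS -cG ltnNge.
case/negP; rewrite -(leq_add2r (#|G : M| + #|G : N|)) addnACA cM cN leq_add2l.
rewrite -(leq_pmul2l (isT : 0 < 2)) mulnDr.
by rewrite [X in _ <= X]mul2n -addnn leq_add.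
Qed.

(** * Structure of Schmidt groups *)

(** The quotient by a maximal normal subgroup is simple and inherits nilpotent proper subgroups, so
    it is solvable and of prime order. *)
Lemma Schmidt_prime_index_normal (gT : finGroupType) (G : {group gT}) :
    Schmidt_group G ->
  exists2 N : {group gT}, N <| G & prime #|G : N|.
Proof.
case=> nnilG nilG.
have ntG : G :!=: 1 by apply/eqP=> G1; case: nnilG; rewrite G1 nilpotent1.
have [N maxN] := ex_maxnormal_ntrivg ntG.
have [/andP[ltNG nNG] _] := maxgroupP maxN.
have nsNG : N <| G by rewrite /normal proper_sub.
exists N => //; rewrite -card_quotient //.
have simGN : simple (G / N) by rewrite quotient_simple.
apply: simple_sol_prime => //; apply: simple_nilpotent_proper_sol => // Hb ltHb.
have [H defHb sNH sHG] := inv_quotientS nsNG (proper_sub ltHb).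
rewrite defHb; apply/quotient_nil/nilG; rewrite properE sHG.
by apply/negP=> /(quotientS N); rewrite -defHb; apply/negP; case/andP: ltHb.
Qed.

Lemma Schmidt_structure (gT : finGroupType) (G : {group gT}) :
    Schmidt_group G ->
  exists (p q : nat) (P Q : {group gT}), Schmidt_decomposition G p q P Q.
Proof.
move=> SchG; have [nnilG nilG] := SchG.
have [N nsNG] := Schmidt_prime_index_normal SchG.
set q := #|G : N| => q_pr; have [sNG nNG] := andP nsNG.
have ltNG : N \proper G by rewrite properE sNG -indexg_gt1 prime_gt1.
have nilN := nilG N ltNG.
have [Q sylQ] := Sylow_exists q G; have [sQG qQ _] := and3P sylQ.
(* Since [#|G : N| = q], the [q^']-core of the nilpotent group [N] is a normal complement to [Q] in
   [G]. *)
pose K := 'O_q^'(N)%G.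
have nsKG : K <| G by apply: gFnormal_trans.
have hallK : q^'.-Hall(G) K.
  have [sKN q'K qK] := and3P (nilpotent_pcore_Hall q^' nilN).
  rewrite /pHall (subset_trans sKN) // q'K -(Lagrange_index sNG sKN).
  by rewrite pnatM qK andbT pnatNK /q pnat_id.
have defG : K * Q = G.
  apply/eqP; rewrite eqEcard mulG_subG normal_sub //= sQG.
  have coKQ : coprime #|K| #|Q|.
    by rewrite coprime_sym (pnat_coprime qQ (pHall_pgroup hallK)).
  rewrite coprime_cardMg // (card_Hall sylQ) (card_Hall hallK).
  by rewrite mulnC partnC ?leqnn ?cardG_gt0.
have ncKQ : ~~ (K \subset 'C(Q)).
  apply/negP=> cKQ; case: nnilG; rewrite -defG mulg_nil 1?centsC //.
  by rewrite (pgroup_nil qQ) (nilpotentS (pcore_sub _ _) nilN).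
(* If [Q] centralized every Sylow subgroup of [K], it would centralize [K], and [G] would be
   nilpotent. *)
have [P [SylP ncP]] : exists P : {group gT}, Sylow K P /\ ~~ (P \subset 'C(Q)).
  have : [exists P : {group gT}, Sylow K P && ~~ (P \subset 'C(Q))].
    apply: contraR ncKQ; rewrite negb_exists => /forallP ncP.
    rewrite -(Sylow_gen K) gen_subG; apply/bigcupsP=> P sylP.
    by move: (ncP P); rewrite sylP negbK.
  by case/existsP=> P /andP[]; exists P.
have [p p_pr sylP] := SylowP _ _ SylP.
have [sPK pP _] := and3P sylP.
have nsPG : P <| G.
  rewrite (nilpotent_Hall_pcore (nilpotentS (pcore_sub _ _) nilN) sylP).
  exact: gFnormal_trans.
have [sPG nPG] := andP nsPG.
have neqpq : p != q.
  apply/eqP=> epq; case/negP: ncP.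
  have q'P := pgroupS sPK (pHall_pgroup hallK).
  suff /eqP -> : P :==: 1 by apply: sub1G.
  by apply/eqP/card1_trivg/(pnat_1 _ q'P); rewrite -epq.
have coPpQ (R : {group gT}) : R \subset Q -> coprime #|P| #|R|.
  move=> sRQ; apply: (pnat_coprime pP); apply: sub_in_pnat (pgroupS sRQ qQ).
  by move=> r _ /= /eqnP ->; rewrite !inE eq_sym.
(* A proper subgroup [P * R] is nilpotent, so its coprime factors commute. With [R = Q] this yields
   [P * Q = G]; with [R] cyclic it yields that [Q] is cyclic. *)
have centE (R : {group gT}) : R \subset Q -> P * R != G -> P \subset 'C(R).
  move=> sRQ neG; have sRG := subset_trans sRQ sQG.
  have nPR := subset_trans sRG nPG; rewrite -norm_joinEr // in neG.
  have nilJ : nilpotent (P <*> R).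
    by apply: nilG; rewrite properEneq neG join_subG sPG.
  apply: (sub_nilpotent_cent2 nilJ); rewrite ?joing_subl ?joing_subr //.
  by rewrite coprime_sym coPpQ.
have defPQ : P * Q = G by apply/eqP; apply: contraR ncP; apply: centE.
have tiPQ : P :&: Q = 1 by apply: coprime_TIg (coPpQ Q _).
have sylPG : p.-Sylow(G) P.
  rewrite /pHall sPG pP -(divgS sPG) -{1}defPQ TI_cardMg // mulKn ?cardG_gt0 //.
  by apply: sub_in_pnat qQ => r _ /= /eqnP ->; rewrite !inE eq_sym.
exists p, q, P, Q; split=> //; last by rewrite sdprodE // (subset_trans sQG).
split=> //; last first.
  (* Were [Q] normal, the commutator of [P] and [Q] would lie in [P :&: Q = 1]. *)
  apply/negP=> /andP[_ nQG]; case/negP: ncP.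
  rewrite (sameP commG1P trivgP) -tiPQ subsetI commg_subl commg_subr.
  by rewrite (subset_trans sPG nQG) (subset_trans sQG nPG).
(* If [Q] is not cyclic, then [P * <[x]>] is proper for each [x] in [Q], so every such [x]
   centralizes [P]. *)
apply: contraR ncP => ncycQ; rewrite centsC; apply/subsetP=> x Qx.
have sxQ : <[x]> \subset Q by rewrite cycle_subG.
rewrite -cycle_subG centsC; apply: centE => //; apply: contraNneq ncycQ => eG.
suff -> : Q :=: <[x]> by apply: cycle_cyclic.
apply/eqP; rewrite eq_sym eqEcard sxQ /= -(leq_pmul2l (cardG_gt0 P)).
rewrite -!TI_cardMg ?eG ?defPQ //; exact: coprime_TIg (coPpQ _ sxQ).
Qed.

Theorem theorem1 (gT : finGroupType) (G : {group gT}) :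
  minimal_non (@Iwasawa gT) G <->
  (exists2 p : nat, prime p & p.-group G /\ minimal_non (@modular_group gT) G)
  \/ (Schmidt_group G /\
      exists (p q : nat) (P Q : {group gT}),
        Schmidt_decomposition G p q P Q /\ modular_group P).
Proof.
split=> [[niwG iwG] | [[p p_pr [pG [nmodG modG]]] | [[nnilG nilG]]]].
- case: (boolP (nilpotent G)) => [nilG | /negP nnilG]; last first.
    have SchG : Schmidt_group G.
      by split=> // H /iwG/IwasawaP[].
    right; split=> //.
    have [p [q [P [Q decG]]]] := Schmidt_structure SchG.
    exists p, q, P, Q; split=> //; case: decG => _ [/pHall_pgroup pP nsPG] _ _.
    apply/Iwasawa_modular/iwG; rewrite properEneq normal_sub // andbT.
    by apply/eqP=> ePG; case: nnilG; rewrite -ePG (pgroup_nil pP).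
  have nmodG : ~ modular_group G by move=> modG; apply/niwG/IwasawaP.
  have pr_p : prime (pdiv #|G|).
    rewrite pdiv_prime // cardG_gt1; apply/eqP=> G1.
    by apply/niwG/abelian_Iwasawa; rewrite G1 abelian1.
  have p_dv := pdiv_dvd #|G|; move: (pdiv _) pr_p p_dv => p pr_p p_dv.
  left; exists p => //; split; last first.
    by split=> // H /iwG/IwasawaP[].
  (* If [G] is not a [p]-group, both cores are proper, the second because [p] divides [#|G|]; hence
     both are Iwasawa, and so is [G]. *)
  apply/idPn=> npG; apply/niwG/(pcore_Iwasawa_nilpotent (pi := p)) => //.
    apply: iwG; rewrite properEneq pcore_sub andbT.
    by apply: contraNneq npG => /= <-; apply: pcore_pgroup.
  apply: iwG; rewrite properEneq pcore_sub andbT; apply/eqP=> /= eG.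
  have := pcore_pgroup p^' G; rewrite eG p'groupEpi mem_primes.
  by rewrite pr_p cardG_gt0 p_dv.
- split=> [/IwasawaP[] // | H ltHG]; apply/IwasawaP; split; last exact: modG.
  exact: nilpotentS (proper_sub ltHG) (pgroup_nil pG).
case=> p [q [P [Q [[_ [sylP nsPG] [sylQ cycQ _] defG] modP]]]].
split=> [/IwasawaP[] // | H ltHG]; have sHG := proper_sub ltHG.
(* The [p]-core of [H] lies in the modular group [P]; the [p^']-core is a [q]-group, conjugate into
   the cyclic [Q] and so abelian. *)
apply: (pcore_Iwasawa_nilpotent (pi := p)); first exact: nilG.
  apply: nilpotent_modular_Iwasawa; first exact: pgroup_nil (pcore_pgroup _ _).
  apply: modular_groupS modP; rewrite (sub_normal_Hall sylP) ?pcore_pgroup //.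
  exact: subset_trans (pcore_sub _ _) sHG.
apply: abelian_Iwasawa; set O := 'O_p^'(H)%G.
have sOG : O \subset G by apply: subset_trans (pcore_sub _ _) sHG.
have qO : q.-group O.
  apply: pnat_dvd (pHall_pgroup sylQ).
  rewrite -(@Gauss_dvdr _ #|P|) ?(sdprod_card defG) ?cardSg // coprime_sym.
  exact: pnat_coprime (pHall_pgroup sylP) (pcore_pgroup _ _).
have [x _ sOxQ] := Sylow_Jsub sylQ sOG qO.
by rewrite -(abelianJ _ x) (abelianS sOxQ) ?cyclic_abelian.
Qed.
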